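(* Let $\mathcal{F}$ be the class of fields, used as forcing class for the factorisation system $(IntClo^o,Int^o)$ on $CRings^o$. A commutative ring is in the saturation $\overline{\mathcal{F}}$ of $\mathcal{F}$ if and only if it is an integrally closed domain.
   Context: $CRings$ is the category of commutative unital rings. For a ring map $A\to B$, an element $b\in B$ is integral over $A$ if it is a root of a monic polynomial with coefficients in $A$. $Int$ is the class of integral maps (ring maps $A\to B$, not necessarily injective, such that every element of $B$ is integral over $A$). $IntClo$ is the class of integrally closed monomorphisms (injective maps $A\subset B$ such that every element of $B$ integral over $A$ is in $A$). $(Int,IntClo)$ is a unique factorisation system on $CRings$ with left class $Int$. A ring $K$ is a point of this system if $K\neq0$ and every finitely presented integral map $K\to B$ with $B\ne0$ admits a retraction. A point covering family of $A$ is a family $\{A\to A_i\}$ of finitely presented integral maps such that every ring map $A\to K$ with $K$ a point factors through some $A\to A_i$. It is $\mathcal{F}$-localising if moreover every ring map from $A$ to a field factors through some $A\to A_i$. The saturation $\overline{\mathcal{F}}$ is the class of rings $B$ such that for every $\mathcal{F}$-localising point covering family $\{A\to A_i\}$ of a ring $A$, every ring map $A\to B$ factors through some $A\to A_i$. An integrally closed domain is an integral domain that is integrally closed in its fraction field. *)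

(* Defs.v *)
From HB Require Import structures.
From mathcomp Require Import all_boot all_order all_algebra.
From mathcomp.multinomials Require Import mpoly.

Set Implicit Arguments.
Unset Strict Implicit.
Unset Printing Implicit Defensive.

Import GRing.Theory.
Local Open Scope ring_scope.

(* The category of commutative unital rings contains the zero ring, so its    *)
(* objects are comPzRingType's and its arrows are {rmorphism _ -> _}.         *)

(* Spelled out because {poly A} requires A to be nonzero.                     *)
Definition integral (A B : comPzRingType) (f : {rmorphism A -> B}) (b : B) :
    Prop :=
  exists (n : nat) (c : 'I_n -> A), b ^+ n + \sum_(i < n) f (c i) * b ^+ i = 0.

Definition integral_map (A B : comPzRingType) (f : {rmorphism A -> B}) : Prop :=
  forall b : B, integral f b.

Definition integrally_closed_mono (A B : comPzRingType)
    (f : {rmorphism A -> B}) : Prop :=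
  injective f /\ forall b : B, integral f b -> exists a : A, f a = b.

Definition nonzero_ring (A : comPzRingType) (A_neq0 : (1 : A) != 0) :
    comNzRingType :=
  HB.pack_for comNzRingType (A : Type) (GRing.ComPzRing.class A)
    (GRing.PzSemiRing_isNonZero.Build A A_neq0).

(* B is, as an A-algebra, the quotient of a polynomial ring A[x_0..x_(n-1)]   *)
(* by the ideal generated by finitely many r_0, .., r_(m-1).  Polynomial      *)
(* rings are only available over nonzero rings; if A = 0 then B = 0 = A is    *)
(* finitely presented, so nothing is required in that case.                   *)
Definition finitely_presented (A B : comPzRingType) (f : {rmorphism A -> B}) :
    Prop :=
  forall A_neq0 : (1 : A) != 0,
  exists (n m : nat)
         (ev : {rmorphism {mpoly (nonzero_ring A_neq0)[n]} -> B})
         (r : 'I_m -> {mpoly (nonzero_ring A_neq0)[n]}),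
    [/\ forall a : A, ev (mpolyC n (a : nonzero_ring A_neq0)) = f a,
        forall b : B, exists p, ev p = b
      & forall p, ev p = 0 <->
          exists c : 'I_m -> {mpoly (nonzero_ring A_neq0)[n]},
            p = \sum_(j < m) c j * r j].

Definition retraction (A B : comPzRingType) (f : {rmorphism A -> B})
    (s : {rmorphism B -> A}) : Prop := forall a : A, s (f a) = a.

Definition point (K : comPzRingType) : Prop :=
  (1 : K) != 0 /\
  forall (B : comPzRingType) (f : {rmorphism K -> B}),
    finitely_presented f -> integral_map f -> (1 : B) != 0 ->
    exists s : {rmorphism B -> K}, retraction f s.

Definition factors_through (A A' B : comPzRingType) (f : {rmorphism A -> A'})
    (g : {rmorphism A -> B}) : Prop :=
  exists h : {rmorphism A' -> B}, forall a : A, h (f a) = g a.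

Definition point_covering_family (A : comPzRingType) (I : Type)
    (A_ : I -> comPzRingType) (f_ : forall i, {rmorphism A -> A_ i}) : Prop :=
  (forall i, finitely_presented (f_ i) /\ integral_map (f_ i)) /\
  forall (K : comPzRingType) (g : {rmorphism A -> K}), point K ->
    exists i, factors_through (f_ i) g.

Definition localising_family (F : comPzRingType -> Prop) (A : comPzRingType)
    (I : Type) (A_ : I -> comPzRingType) (f_ : forall i, {rmorphism A -> A_ i}) :
    Prop :=
  point_covering_family f_ /\
  forall (K : comPzRingType) (g : {rmorphism A -> K}), F K ->
    exists i, factors_through (f_ i) g.

Definition saturation (F : comPzRingType -> Prop) (B : comPzRingType) : Prop :=
  forall (A : comPzRingType) (I : Type) (A_ : I -> comPzRingType)
         (f_ : forall i, {rmorphism A -> A_ i}),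
    localising_family F f_ ->
    forall g : {rmorphism A -> B}, exists i, factors_through (f_ i) g.

(* A fieldType or an idomainType carries a chosen inverse operation, which a  *)
(* bare ring does not; hence the isomorphisms below.                          *)
Definition is_field (K : comPzRingType) : Prop :=
  exists (k : fieldType) (e : {rmorphism K -> k}), bijective e.

Definition integrally_closed_domain (B : comPzRingType) : Prop :=
  exists (D : idomainType) (e : {rmorphism B -> D}), bijective e /\
    integrally_closed_mono (@tofrac D : {rmorphism D -> {fraction D}}).

(* Main.v *)
Require Import Defs.
From HB Require Import structures.
From mathcomp Require Import all_boot all_order all_algebra.
From mathcomp.classical Require Import boolp.
From mathcomp.multinomials Require Import mpoly.

Set Implicit Arguments.
Unset Strict Implicit.
Unset Printing Implicit Defensive.

Import GRing.Theory.
Local Open Scope ring_scope.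
Local Open Scope quotient_scope.

(** If [B] is an integrally closed domain with fraction field [K], and a
    localising family [A -> A_i] is given, then [A -> B -> K] factors through
    some [h : A_i -> K].  As [A_i] is integral over [A], the image of [h] is
    integral over [B], so [h] takes its values in [B] and gives the required
    factorisation ([integrally_closed_domain_saturation]).

    For the converse, a point is a field up to isomorphism: if [u] is an element
    of a point [K], then [K / (u)] is a finitely presented integral [K]-algebra,
    so either it is zero and [u] is a unit, or [K -> K / (u)] has a retraction
    and [u = 0] ([point_zero_or_unit]).  Hence for a family of finitely
    presented integral maps, being a localising family only has to be tested on
    nonzero rings in which every element is zero or a unit.

    A finitely presented [B]-algebra is a finite system of polynomial equations
    over [B], and the maps from it to a [B]-algebra [K] are the solutions of the
    system in [K] ([presented_mapP]).  Applied to families of [B]-algebras and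
    the identity of [B], saturation thus says: if every field over [B] solves
    one of the systems of a family whose algebras are integral, then so does [B]
    itself ([saturation_solvable]).  Three families then suffice:
    - the empty family, if [B = 0], shows that [B] is nonzero
      ([saturation_neq0]);
    - the systems [a = 0] and [b = 0], when [a * b = 0], show that [B] is a
      domain ([saturation_mulf]);
    - if [p / q] is a root of a monic polynomial [f] over [B], every field over
      [B] solves [q = 0] or the system [f(x) = 0, q * x = p]; hence so does [B],
      and as [q != 0] the fraction [p / q] lies in [B] ([saturation_ratio]).
*)

(** * The quotient of a ring by a finitely generated ideal *)
Section GeneratedQuotient.

Variables (R : comPzRingType) (m : nat) (r : 'I_m -> R).

Definition in_gen_ideal (x : R) : Prop := exists c, x = \sum_(j < m) c j * r j.

(** Membership is made boolean classically, as quotients of types are taken by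
    boolean equivalence relations. *)
Definition gen_ideal : {pred R} := fun x => `[< in_gen_ideal x >].

Lemma gen_idealP x : reflect (in_gen_ideal x) (x \in gen_ideal).
Proof. exact: asboolP. Qed.

Lemma gen_ideal_zmod_closed : zmod_closed gen_ideal.
Proof.
split=> [|_ _ /gen_idealP[c ->] /gen_idealP[d ->]]; apply/gen_idealP.
  by exists (fun=> 0); rewrite big1 // => j _; rewrite mul0r.
exists (fun j => c j - d j); rewrite -sumrB.
by apply: eq_bigr => j _; rewrite mulrBl.
Qed.

HB.instance Definition _ := GRing.isZmodClosed.Build R gen_ideal
  gen_ideal_zmod_closed.

Lemma gen_ideal_mul a x : x \in gen_ideal -> a * x \in gen_ideal.
Proof.
case/gen_idealP=> c ->; apply/gen_idealP; exists (fun j => a * c j).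
by rewrite mulr_sumr; apply: eq_bigr => j _; rewrite mulrA.
Qed.

Lemma mem_gen_ideal j : r j \in gen_ideal.
Proof.
apply/gen_idealP; exists (fun i => (i == j)%:R).
rewrite (bigD1 j) //= eqxx mul1r big1 ?addr0 // => i /negPf->.
by rewrite mul0r.
Qed.

(** The ideal may contain [1], so that the quotient can be the zero ring: this
    case decides whether an element is a unit in [point_zero_or_unit]. *)
Definition gen_quot := @Quotient.quot R gen_ideal.

HB.instance Definition _ := GRing.Zmodule.on gen_quot.

Definition gen_pi (x : R) : gen_quot := \pi x.

Lemma gen_pi_eq x y : gen_pi x = gen_pi y <-> x - y \in gen_ideal.
Proof.
by split=> [e|]; [rewrite Quotient.idealrBE; apply/eqP |
                  rewrite Quotient.idealrBE => /eqP].
Qed.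

Lemma gen_piK (x : gen_quot) : gen_pi (repr x) = x.
Proof. exact: reprK. Qed.

Lemma gen_pi_additive : zmod_morphism gen_pi.
Proof. by move=> x y; rewrite /gen_pi !piE. Qed.

HB.instance Definition _ :=
  GRing.isZmodMorphism.Build R gen_quot gen_pi gen_pi_additive.

Definition gen_quot_one : gen_quot := gen_pi 1.
Definition gen_quot_mul (x y : gen_quot) : gen_quot :=
  gen_pi (repr x * repr y).

Lemma gen_piM x y :
  gen_pi (x * y) = gen_quot_mul (gen_pi x) (gen_pi y).
Proof.
apply/gen_pi_eq; set x' := repr _; set y' := repr _.
have ex : x - x' \in gen_ideal by apply/gen_pi_eq; rewrite gen_piK.
have ey : y - y' \in gen_ideal by apply/gen_pi_eq; rewrite gen_piK.
have -> : x * y - x' * y' = y * (x - x') + x' * (y - y').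
  by rewrite !mulrBr [y * x]mulrC [y * x']mulrC addrA subrK.
by rewrite rpredD // gen_ideal_mul.
Qed.

Fact gen_quot_mulA : associative gen_quot_mul.
Proof.
by move=> x y z; rewrite -[x]gen_piK -[y]gen_piK -[z]gen_piK -!gen_piM mulrA.
Qed.

Fact gen_quot_mulC : commutative gen_quot_mul.
Proof. by move=> x y; rewrite -[x]gen_piK -[y]gen_piK -!gen_piM mulrC. Qed.

Fact gen_quot_mul1 : left_id gen_quot_one gen_quot_mul.
Proof. by move=> x; rewrite -[x]gen_piK -gen_piM mul1r. Qed.

Fact gen_quot_mulD : left_distributive gen_quot_mul +%R.
Proof.
move=> x y z; rewrite -[x]gen_piK -[y]gen_piK -[z]gen_piK.
by rewrite -raddfD -!gen_piM mulrDl raddfD.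
Qed.

HB.instance Definition _ := GRing.Zmodule_isComPzRing.Build gen_quot
  gen_quot_mulA gen_quot_mulC gen_quot_mul1 gen_quot_mulD.

Fact gen_pi_monoid_morphism : monoid_morphism gen_pi.
Proof. by split=> // x y; rewrite gen_piM. Qed.

HB.instance Definition _ :=
  GRing.isMonoidMorphism.Build R gen_quot gen_pi gen_pi_monoid_morphism.

Lemma gen_pi_eq0 x : gen_pi x = 0 <-> in_gen_ideal x.
Proof. by rewrite -(rmorph0 gen_pi) gen_pi_eq subr0; split=> /gen_idealP. Qed.

Lemma gen_quot_lift (S : comPzRingType) (e : {rmorphism R -> S}) :
    (forall j, e (r j) = 0) ->
  exists h : {rmorphism gen_quot -> S}, forall x, h (gen_pi x) = e x.
Proof.
move=> er0; pose h (x : gen_quot) := e (repr x).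
have hpi x : h (gen_pi x) = e x.
  apply/eqP; rewrite /h -subr_eq0 -rmorphB.
  have /gen_idealP[c ->]: repr (gen_pi x) - x \in gen_ideal.
    by apply/gen_pi_eq; rewrite gen_piK.
  by rewrite rmorph_sum big1 //= => j _; rewrite rmorphM er0 mulr0.
have hB : zmod_morphism h.
  move=> x y; rewrite -[x]gen_piK -[y]gen_piK -raddfB.
  by rewrite !hpi rmorphB.
have hM : monoid_morphism h.
  split=> [|x y]; first by rewrite -(rmorph1 gen_pi) hpi rmorph1.
  by rewrite -[x]gen_piK -[y]gen_piK -rmorphM !hpi rmorphM.
pose hA := GRing.isZmodMorphism.Build _ _ h hB.
pose hMM := GRing.isMonoidMorphism.Build _ _ h hM.
pose H : {rmorphism gen_quot -> S} := HB.pack h hA hMM.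
by exists H.
Qed.

End GeneratedQuotient.

(** * Algebras presented by generators and relations *)
Lemma rmorph_mpoly_mmap (n : nat) (R S : comNzRingType)
    (e : {rmorphism {mpoly R[n]} -> S}) (p : {mpoly R[n]}) :
  e p = mmap (fun a => e a%:MP) (fun i => e 'X_i) p.
Proof.
rewrite {1}[p]mpolyE rmorph_sum; apply: eq_bigr => mu _ /=.
rewrite -mul_mpolyC rmorphM; congr (_ * _).
by rewrite mpolyXE_id rmorph_prod; apply: eq_bigr => i _; rewrite rmorphXn.
Qed.

Section Presentation.

Variables (A : comPzRingType) (A1 : (1 : A) != 0) (n m : nat).
Local Notation A' := (nonzero_ring A1).
Variable r : 'I_m -> {mpoly A'[n]}.

Definition presented_ring : comPzRingType := gen_quot r.

Definition presentation : {rmorphism {mpoly A'[n]} -> presented_ring} :=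
  @gen_pi {mpoly A'[n]} m r.

Definition presented_map : {rmorphism A -> presented_ring} :=
  presentation \o (@mpolyC n A' : {rmorphism A' -> {mpoly A'[n]}}).

Lemma presented_map_fp : finitely_presented presented_map.
Proof.
move=> A1'; rewrite (bool_irrelevance A1' A1).
exists n, m, presentation, r; split=> //; last by move=> p; apply: gen_pi_eq0.
by move=> b; exists (repr b); apply: gen_piK.
Qed.

Lemma presentation_rel j : presentation (r j) = 0.
Proof. by apply/gen_pi_eq0/gen_idealP/mem_gen_ideal. Qed.

(** Substitution of the values [v] for the variables, over the base change [g]. *)
Definition evalm (K : comPzRingType) (K1 : (1 : K) != 0)
    (g : {rmorphism A -> K}) (v : 'I_n -> K) :
    {rmorphism {mpoly A'[n]} -> nonzero_ring K1} :=
  @mmap n A' (nonzero_ring K1) (g : {rmorphism A' -> nonzero_ring K1}) v.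

Lemma evalmC K K1 g v a : @evalm K K1 g v a%:MP = g a.
Proof. exact: mmapC. Qed.

Lemma evalmX K K1 g v i : @evalm K K1 g v 'X_i = v i.
Proof. by rewrite /evalm /= mmapX mmap1U. Qed.

(** The presented algebra is the universal one in which the relations have a
    solution, namely the classes of the variables. *)
Lemma presented_mapP (K : comPzRingType) (K1 : (1 : K) != 0)
    (g : {rmorphism A -> K}) :
  factors_through presented_map g <->
  exists v, forall j, evalm K1 g v (r j) = 0.
Proof.
split=> [[h hg]|[v v0]].
  pose e : {rmorphism {mpoly A'[n]} -> nonzero_ring K1} := h \o presentation.
  exists (fun i => e 'X_i) => j.
  transitivity (e (r j)); last by rewrite /e /= presentation_rel rmorph0.
  rewrite [RHS]rmorph_mpoly_mmap /evalm /=; apply: eq_bigr => mu _.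
  by rewrite -hg.
have [h hv] := gen_quot_lift v0.
by exists (h : {rmorphism presented_ring -> K}) => a; rewrite hv evalmC.
Qed.

End Presentation.

(** * Integral elements *)
Lemma monicXnD (R : nzRingType) (k : nat) (c : 'I_k -> R) :
  'X^k + \sum_(i < k) (c i) *: 'X^i \is monic.
Proof.
have sz : (size (\sum_(i < k) c i *: 'X^i)%R < size ('X^k : {poly R})%R)%N.
  rewrite size_polyXn ltnS; apply: (leq_trans (size_sum _ _ _)).
  apply/bigmax_leqP => i _; apply: leq_trans (size_scale_leq _ _) _.
  by rewrite size_polyXn.
by rewrite monicE lead_coefDl // lead_coefXn.
Qed.

Lemma integral_integralOver (A B : comNzRingType) (f : {rmorphism A -> B})
    (b : B) :
  integral f b <-> integralOver f b.
Proof.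
split=> [[k [c cb]]|[p mp /rootP pb]].
  exists ('X^k + \sum_(i < k) c i *: 'X^i); first exact: monicXnD.
  rewrite rmorphD rmorph_sum /= map_polyXn rootE hornerD hornerXn horner_sum.
  apply/eqP; rewrite -[RHS]cb; congr (_ + _); apply: eq_bigr => i _.
  by rewrite map_polyZ map_polyXn hornerZ hornerXn.
exists (size p).-1, (fun i => p`_i).
rewrite -[RHS]pb horner_coef size_map_poly_id0; last first.
  by rewrite (monicP mp) rmorph1 oner_neq0.
have sp : size p = (size p).-1.+1 by rewrite prednK // size_poly_gt0 monic_neq0.
rewrite [in RHS]sp big_ord_recr coef_map -lead_coefE (monicP mp).
rewrite [LHS]addrC; congr (_ + _); last by rewrite /= rmorph1 mul1r.
by apply: eq_bigr => i _; rewrite coef_map.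
Qed.

(** The image of a polynomial ring is generated by the images of the variables,
    and integral elements form a subalgebra. *)
Lemma integral_mpoly (n : nat) (A S : comNzRingType)
    (e : {rmorphism {mpoly A[n]} -> S}) (f : {rmorphism A -> S}) :
    (forall a, e a%:MP = f a) -> (forall i, integral f (e 'X_i)) ->
  forall p, integral f (e p).
Proof.
move=> eC intX p; apply/integral_integralOver.
elim/mpolyind: p => [|c mu p _ _ IHp].
  by rewrite rmorph0; apply: integral0.
rewrite rmorphD; apply: integral_add => //.
rewrite -mul_mpolyC rmorphM eC; apply: integral_mul; first exact: integral_id.
rewrite mpolyXE_id rmorph_prod.
elim/big_rec: _ => [|i x _ IHx]; first exact: integral1.
apply: integral_mul IHx; rewrite rmorphXn.
elim: (mu i) => [|k IHk]; first exact: integral1.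
by rewrite exprS; apply: integral_mul IHk; apply/integral_integralOver.
Qed.

Lemma presented_map_integral (A : comPzRingType) (A1 : (1 : A) != 0)
    (n m : nat) (r : 'I_m -> {mpoly (nonzero_ring A1)[n]}) :
  (forall i, integral (presented_map r) (presentation r 'X_i)) ->
  integral_map (presented_map r).
Proof.
move=> intX b; case: (eqVneq (1 : presented_ring r) 0) => [Q0|Q1].
  (* in the zero ring, 1 = 0 is an integral equation of degree zero *)
  by exists 0%N, (fun=> 0); rewrite big_ord0 addr0; exact: Q0.
rewrite -[b]gen_piK.
exact: (@integral_mpoly n (nonzero_ring A1) (nonzero_ring Q1)
  (presentation r) (presented_map r) (fun=> erefl) intX).
Qed.

(** * Points are fields *)

(** Fields, without a chosen inverse operation. *)
Definition zero_or_unit (K : comPzRingType) : Prop :=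
  (1 : K) != 0 /\ forall u : K, u = 0 \/ exists w, w * u = 1.

Lemma is_field_zero_or_unit K : is_field K -> zero_or_unit K.
Proof.
case=> k [e [d ed de]].
have e0 x : e x = 0 -> x = 0.
  by move=> ex; apply: (can_inj ed); rewrite ex rmorph0.
split; first by apply/eqP => /(congr1 e)/eqP; rewrite rmorph1 rmorph0 oner_eq0.
move=> u; case: (eqVneq (e u) 0) => [/e0|u0]; first by left.
right; exists (d (e u)^-1); apply: (can_inj ed).
by rewrite rmorphM rmorph1 de mulVf.
Qed.

(** The single relation [a = 0] in no variables, which presents [A / (a)]. *)
Definition const_rel (A : comPzRingType) (A1 : (1 : A) != 0) (a : A) :
    'I_1 -> {mpoly (nonzero_ring A1)[0]} :=
  fun=> (a : nonzero_ring A1)%:MP.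

Lemma const_rel_integral A A1 a :
  integral_map (presented_map (@const_rel A A1 a)).
Proof. by apply: presented_map_integral => -[]. Qed.

(** The quotient by [(u)] is either zero, which makes [u] a unit, or retracts
    onto [K], which forces [u = 0] since [u] vanishes in it. *)
Lemma point_zero_or_unit K : point K -> zero_or_unit K.
Proof.
case=> K1 retr; split=> // u.
have fu0 : presented_map (const_rel K1 u) u = 0.
  exact: (presentation_rel (const_rel K1 u) ord0).
have [Q0|Q1] := eqVneq (1 : presented_ring (const_rel K1 u)) 0; last first.
  have [s sK] := retr _ _ (presented_map_fp _)
    (@const_rel_integral K K1 u) Q1.
  by left; rewrite -[u]sK fu0 rmorph0.
right; have /gen_pi_eq0[c] : presentation (const_rel K1 u) 1 = 0.
  by rewrite rmorph1.
rewrite big_ord1 => c1.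
pose ev := evalm (n := 0) K1 K1 (idfun : {rmorphism K -> K}) (fun=> 0).
exists (ev (c ord0)).
have := congr1 ev c1; rewrite rmorph1 rmorphM /ev evalmC => e; exact: esym e.
Qed.

(** * Saturated rings are integrally closed domains *)

(** The systems [r i] present a family of [B]-algebras; the hypotheses say that
    it is localising, and saturation is applied to the identity of [B]. *)
Lemma saturation_solvable (B : comPzRingType) (B1 : (1 : B) != 0)
    (I : Type) (n m : I -> nat)
    (r : forall i, 'I_(m i) -> {mpoly (nonzero_ring B1)[n i]}) :
  saturation is_field B ->
  (forall i, integral_map (presented_map (r i))) ->
  (forall (K : comPzRingType) (K1 : (1 : K) != 0) (g : {rmorphism B -> K}),
     zero_or_unit K -> exists i v, forall j, evalm B1 K1 g v (r i j) = 0) ->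
  exists i v, forall j, evalm B1 B1 (idfun : {rmorphism B -> B}) v (r i j) = 0.
Proof.
move=> satB intr solK.
have cov (K : comPzRingType) (g : {rmorphism B -> K}) :
    zero_or_unit K -> exists i, factors_through (presented_map (r i)) g.
  move=> KU; have [i vP] := solK K (proj1 KU) g KU.
  by exists i; apply/(presented_mapP (r i) (proj1 KU)).
have [|i /(presented_mapP (r i) B1)] :=
  satB B I (fun i => presented_ring (r i)) (fun i => presented_map (r i)) _
    (idfun : {rmorphism B -> B}); last by exists i.
split; last by move=> K g /is_field_zero_or_unit; apply: cov.
split; last by move=> K g /point_zero_or_unit; apply: cov.
by move=> i; split=> //; apply: presented_map_fp.
Qed.

(** The zero ring maps to no field, so there the empty family is localising; but
    nothing factors through a member of the empty family. *)
Lemma saturation_neq0 (B : comPzRingType) :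
  saturation is_field B -> (1 : B) != 0.
Proof.
move=> satB; apply/eqP => B0.
have noK (K : comPzRingType) (g : {rmorphism B -> K}) : ~ zero_or_unit K.
  by case=> /eqP K1 _; apply: K1; rewrite -(rmorph1 g) B0 rmorph0.
have [|[]] := satB B void (fun=> B) (fun=> idfun) _ idfun.
split; last by move=> K g /is_field_zero_or_unit /noK.
by split=> [[]|K g /point_zero_or_unit /noK]; case.
Qed.

(** In a field over [B] one of [a] and [b] vanishes, so the quotients of [B] by
    [(a)] and by [(b)] form a localising family. *)
Lemma saturation_mulf (B : comPzRingType) (a b : B) :
  saturation is_field B -> a * b = 0 -> a = 0 \/ b = 0.
Proof.
move=> satB ab; have B1 := saturation_neq0 satB.
have [||i [v]] := saturation_solvable (B1 := B1) (I := bool)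
  (r := fun i : bool => const_rel B1 (if i then a else b)) satB.
- by move=> i; apply: const_rel_integral.
- move=> K K1 g [_ KU].
  have [ga|[w wga]] := KU (g a).
    by exists true, (fun=> 0) => j; rewrite evalmC.
  exists false, (fun=> 0) => j; rewrite evalmC.
  by rewrite -[LHS]mul1r -wga -mulrA -rmorphM ab rmorph0 mulr0.
- by move=> /(_ ord0); rewrite evalmC; case: i; [left|right].
Qed.

(** The relations [x ^ k + sum c_i x ^ i = 0] and [q x = p]: the unknown is a
    fraction [p / q] that is integral with the given equation. *)
Definition ratio_rel (A : comPzRingType) (A1 : (1 : A) != 0) (p q : A) (k : nat)
    (c : 'I_k -> A) : 'I_2 -> {mpoly (nonzero_ring A1)[1]} :=
  fun j => if j == ord0
    then 'X_ord0 ^+ k + \sum_(i < k) (c i : nonzero_ring A1)%:MP * 'X_ord0 ^+ i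
    else (q : nonzero_ring A1)%:MP * 'X_ord0 - (p : nonzero_ring A1)%:MP.

Lemma evalm_ratio_rel (A K : comPzRingType) (A1 : (1 : A) != 0)
    (K1 : (1 : K) != 0) (g : {rmorphism A -> K}) (p q : A) (k : nat)
    (c : 'I_k -> A) (v : 'I_1 -> K) :
  (forall j, evalm A1 K1 g v (ratio_rel A1 p q c j) = 0) <->
  v ord0 ^+ k + \sum_(i < k) g (c i) * v ord0 ^+ i = 0 /\ g q * v ord0 = g p.
Proof.
have e0 : evalm A1 K1 g v (ratio_rel A1 p q c ord0) =
    v ord0 ^+ k + \sum_(i < k) g (c i) * v ord0 ^+ i.
  rewrite /ratio_rel eqxx rmorphD rmorphXn rmorph_sum evalmX; congr (_ + _).
  by apply: eq_bigr => i _; rewrite rmorphM rmorphXn evalmC evalmX.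
have e1 : evalm A1 K1 g v (ratio_rel A1 p q c ord_max) = g q * v ord0 - g p.
  by rewrite /ratio_rel /= rmorphB rmorphM !evalmC evalmX.
split=> [r0|[x0 qx] j]; last first.
  case: (unliftP ord0 j) => [i ->|->]; last by rewrite e0.
  have -> : lift ord0 i = ord_max :> 'I_2 by apply/val_inj; rewrite (ord1 i).
  by rewrite e1 qx subrr.
by split; [rewrite -e0 r0|apply/eqP; rewrite -subr_eq0 -e1 r0].
Qed.

Lemma ratio_rel_integral A A1 p q k c :
  integral_map (presented_map (@ratio_rel A A1 p q k c)).
Proof.
apply: presented_map_integral => i; rewrite (ord1 i); exists k, c.
have := presentation_rel (ratio_rel A1 p q c) ord0.
rewrite /ratio_rel eqxx rmorphD rmorphXn rmorph_sum => e; rewrite -[RHS]e.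
by congr (_ + _); apply: eq_bigr => j _; rewrite rmorphM rmorphXn.
Qed.

(** The hypothesis on [p] and [q] is the integral equation of [p / q] cleared of
    denominators.  Over a field, either [q] vanishes or [p / q] makes sense and
    satisfies it; so the quotient by [(q)] and the algebra of [ratio_rel] form a
    localising family.  In [B] itself, [q] does not vanish. *)
Lemma saturation_ratio (B : comPzRingType) (p q : B) (k : nat) (c : 'I_k -> B) :
    saturation is_field B -> q != 0 ->
    p ^+ k + \sum_(i < k) c i * p ^+ i * q ^+ (k - i) = 0 ->
  exists x, q * x = p.
Proof.
move=> satB q0 pq; have B1 := saturation_neq0 satB.
pose m (i : bool) := if i then 1%N else 2%N.
pose n (i : bool) := if i then 0%N else 1%N.
pose r (i : bool) : 'I_(m i) -> {mpoly (nonzero_ring B1)[n i]} :=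
  if i return 'I_(m i) -> {mpoly (nonzero_ring B1)[n i]}
  then const_rel B1 q else ratio_rel B1 p q c.
have [||[] [v]] := saturation_solvable (B1 := B1) (r := r) satB.
- case; [exact: const_rel_integral|exact: ratio_rel_integral].
- move=> K K1 g [_ KU].
  have [gq|[w wgq]] := KU (g q).
    by exists true, (fun=> 0) => j; rewrite evalmC.
  exists false, (fun=> w * g p); apply/evalm_ratio_rel.
  split; last by rewrite mulrA [g q * w]mulrC wgq mul1r.
  (* w is the inverse of q in K, so w ^ k turns the homogeneous equation
     into the one satisfied by w * p *)
  have := congr1 (fun z => w ^+ k * g z) pq.
  rewrite rmorph0 mulr0 rmorphD rmorph_sum => e; rewrite -[RHS]e.
  rewrite mulrDr mulr_sumr exprMn rmorphXn; congr (_ + _).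
  apply: eq_bigr => i _; rewrite !rmorphM !rmorphXn exprMn.
  have wq : w ^+ (k - i) * g q ^+ (k - i) = 1 by rewrite -exprMn wgq expr1n.
  have -> : w ^+ k = w ^+ (k - i) * w ^+ i.
    by rewrite -exprD subnK // ltnW.
  transitivity (g (c i) * g p ^+ i * w ^+ i * (w ^+ (k - i) * g q ^+ (k - i))).
    by rewrite wq mulr1 mulrA mulrAC.
  by rewrite [w ^+ (k - i) * w ^+ i]mulrC [RHS]mulrACA [w ^+ i * _]mulrC.
- by move=> /(_ ord0); rewrite evalmC => /eqP; rewrite (negPf q0).
- by case/evalm_ratio_rel=> _ qx; exists (v ord0).
Qed.

(** The inverse operation demanded by [idomainType] is obtained by choice. *)
Lemma domain_idomainType (B : comPzRingType) :
    (1 : B) != 0 -> (forall a b : B, a * b = 0 -> a = 0 \/ b = 0) ->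
  exists (D : idomainType) (e : {rmorphism B -> D}), bijective e.
Proof.
move=> B1 mulf; pose B' := nonzero_ring B1.
pose unit : pred B' := fun x => `[< exists y : B', y * x = 1 >].
pose inv (x : B') : B' :=
  if pselect (exists y : B', y * x = 1) is left ex then sval (cid ex) else x.
have mulVx : {in unit, left_inverse 1 inv *%R}.
  by move=> x /asboolP ex; rewrite /inv; case: pselect => // ex'; case: cid.
have unitPl (x y : B') : y * x = 1 -> unit x.
  by move=> yx; apply/asboolP; exists y.
have inv_out : {in [predC unit], inv =1 id}.
  by move=> x; rewrite inE /= /inv; case: pselect => // ex /asboolP[].
pose U := GRing.ComNzRing_hasMulInverse.Build B' mulVx unitPl inv_out.
pose BU : comUnitRingType :=
  HB.pack_for comUnitRingType (B' : Type) (GRing.ComNzRing.class B') U.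
have mulf0 : GRing.integral_domain_axiom BU.
  by move=> x y /mulf[]->; rewrite eqxx ?orbT.
pose BI := GRing.ComUnitRing_isIntegral.Build BU mulf0.
pose D : idomainType :=
  HB.pack_for idomainType (BU : Type) (GRing.ComUnitRing.class BU) BI.
by exists D, (idfun : {rmorphism B -> B}); exists id.
Qed.

Lemma tofrac_ratio (D : idomainType) (z : {fraction D}) :
  exists p q : D, q != 0 /\ z * tofrac q = tofrac p.
Proof.
elim/quotW: z => x; exists x.1, x.2; split; first exact: denom_ratioP.
rewrite -{1}[x]FracField.Ratio_numden; unlock tofrac.
rewrite -[LHS]FracField.pi_mul; apply/eqP.
rewrite FracField.equivf_def /FracField.mulf.
rewrite !numden_Ratio ?mulf_neq0 ?oner_neq0 ?denom_ratioP //.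
by rewrite !mulr1 mulrC.
Qed.

Lemma saturation_integrally_closed_domain (B : comPzRingType) :
  saturation is_field B -> integrally_closed_domain B.
Proof.
move=> satB.
have [D [e be]] := domain_idomainType (saturation_neq0 satB)
  (fun a b => saturation_mulf satB (a := a) (b := b)).
exists D, e; split=> //; have [d ed de] := be.
split; first by move=> x y /eqP; rewrite tofrac_eq => /eqP.
move=> z [k [c cz]]; have [p [q [q0 zq]]] := tofrac_ratio z.
have [|| x qx] := @saturation_ratio B (d p) (d q) k (d \o c) satB.
- by apply: contra_neq q0 => dq; rewrite -[q]de dq rmorph0.
- apply: (can_inj ed); apply/eqP; rewrite rmorph0 -tofrac_eq0; apply/eqP.
  (* multiplying by q ^ k clears the denominators of the equation of z = p / q *)
  have := congr1 (fun z => z * tofrac q ^+ k) cz.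
  rewrite mul0r mulrDl mulr_suml -exprMn zq => eq; rewrite -[RHS]eq.
  rewrite rmorphD rmorphXn de rmorphD rmorphXn; congr (_ + _).
  rewrite !rmorph_sum; apply: eq_bigr => i _ /=.
  rewrite !rmorphM !rmorphXn !de /= -!mulrA; congr (_ * _).
  have -> : tofrac q ^+ k = tofrac q ^+ i * tofrac q ^+ (k - i).
    by rewrite -exprD subnKC // ltnW.
  by rewrite mulrA -exprMn zq.
have qF0 : tofrac q != 0 by rewrite tofrac_eq0.
exists (e x); apply: (mulIf qF0).
by rewrite zq -tofracM mulrC -{1}[q]de -rmorphM qx de.
Qed.

(** * Integrally closed domains are saturated *)

(** Over the fraction field a factorisation exists, and integrality confines its
    values to the domain. *)
Lemma integrally_closed_domain_saturation (B : comPzRingType) :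
  integrally_closed_domain B -> saturation is_field B.
Proof.
case=> D [e [[d ed de] [injF closedF]]] A I A_ f_ [[fpint _] covF] g.
pose iota : {rmorphism D -> {fraction D}} := @tofrac D.
have [|i [h hg]] := covF {fraction D} (iota \o e \o g).
  by exists {fraction D}, idfun; exists id.
exists i.
have inD x : exists b, tofrac (e b) = h x.
  have [|b eb] := closedF (h x); last by exists (d b); rewrite de.
  have [k [c cx]] := (proj2 (fpint i)) x.
  exists k, (e \o g \o c); have := congr1 h cx.
  rewrite rmorph0 rmorphD rmorphXn rmorph_sum => eq; rewrite -[RHS]eq.
  by congr (_ + _); apply: eq_bigr => j _; rewrite rmorphM rmorphXn hg.
pose s x := sval (cid (inD x)).
have sE x : iota (e (s x)) = h x by rewrite /s; case: cid.
have inj : injective (iota \o e) by apply: inj_comp injF (can_inj ed).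
have sB : zmod_morphism s.
  by move=> x y; apply: inj; rewrite /= sE !rmorphB !sE.
have sM : monoid_morphism s.
  by split=> [|x y]; apply: inj; rewrite /= sE ?rmorph1 // !rmorphM !sE.
pose S : {rmorphism A_ i -> B} := HB.pack s
  (GRing.isZmodMorphism.Build _ _ s sB) (GRing.isMonoidMorphism.Build _ _ s sM).
by exists S => a; apply: inj; rewrite /= sE hg.
Qed.

Theorem proposition111 (B : comPzRingType) :
  saturation is_field B <-> integrally_closed_domain B.
Proof.
split; first exact: saturation_integrally_closed_domain.
exact: integrally_closed_domain_saturation.
Qed.
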